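(* Let $\mathcal{E}_1,\ldots,\mathcal{E}_k$ be $k$ vector spaces over $\mathbb{K}$, let $\sigma$ be a permutation of $\{1,2,\ldots,k\}$, and let $$U_\sigma\in\mathcal{L}(\mathcal{E}_1\otimes\mathcal{E}_2\otimes\cdots\otimes\mathcal{E}_k,\ \mathcal{E}_{\sigma(1)}\otimes\mathcal{E}_{\sigma(2)}\otimes\cdots\otimes\mathcal{E}_{\sigma(k)})$$ be the $\sigma$-tensor permutation operator. Then for all $\phi_1\in\mathcal{L}(\mathcal{E}_1)$, $\phi_2\in\mathcal{L}(\mathcal{E}_2)$, ..., $\phi_k\in\mathcal{L}(\mathcal{E}_k)$, $$U_\sigma\cdot(\phi_1\otimes\phi_2\otimes\cdots\otimes\phi_k)=(\phi_{\sigma(1)}\otimes\phi_{\sigma(2)}\otimes\cdots\otimes\phi_{\sigma(k)})\cdot U_\sigma .$$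
   Context: $\mathbb{K}=\mathbb{R}$ or $\mathbb{C}$. $\mathcal{L}(V,W)$ is the space of $\mathbb{K}$-linear maps from $V$ to $W$, and $\mathcal{L}(V)=\mathcal{L}(V,V)$; the dot denotes composition. The $\sigma$-tensor permutation operator is the linear operator $U_\sigma:\mathcal{E}_1\otimes\cdots\otimes\mathcal{E}_k\to\mathcal{E}_{\sigma(1)}\otimes\cdots\otimes\mathcal{E}_{\sigma(k)}$ defined by $U_\sigma(x_1\otimes x_2\otimes\cdots\otimes x_k)=x_{\sigma(1)}\otimes x_{\sigma(2)}\otimes\cdots\otimes x_{\sigma(k)}$ for all $x_1\in\mathcal{E}_1,\ldots,x_k\in\mathcal{E}_k$. *)

(* Defs.v *)
From HB Require Import structures.
From mathcomp Require Import all_boot all_fingroup all_algebra.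
From mathcomp Require Import finmap boolp reals.
From mathcomp Require Import complex generic_quotient ring_quotient.
From mathcomp.multinomials Require Import monalg.

Set Implicit Arguments.
Unset Strict Implicit.
Unset Printing Implicit Defensive.

Import GRing.Theory.
Import Quotient.Exports.

Local Open Scope ring_scope.
Local Open Scope quotient_scope.

Section Multilinear.
Variables (K : fieldType) (k : nat) (E : 'I_k -> lmodType K) (W : lmodType K).

Definition multilinear (f : (forall i, E i) -> W) : Prop :=
  forall (v : forall i, E i) (i : 'I_k) (a : K) (x y : E i),
    f (dfwith v (a *: x + y)) = a *: f (dfwith v x) + f (dfwith v y).

Record mlmap := MLMap {
  mlfun :> (forall i, E i) -> W;
  mlfunP : multilinear mlfun }.

End Multilinear.

Section TensorProduct.
Variables (K : fieldType) (k : nat) (E : 'I_k -> lmodType K).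

(* The vector space with basis the set E_1 x ... x E_k; << v >> is the basis
   vector attached to the tuple v. *)
Definition tfree := {malg K[forall i, E i]}.

(* The subspace spanned by the multilinearity relators. *)
Inductive trel : tfree -> Prop :=
| trel_mlin (v : forall i, E i) (i : 'I_k) (a : K) (x y : E i) :
    trel (<< dfwith v (a *: x + y) >>
          - (a *: << dfwith v x >> + << dfwith v y >>))
| trel0 : trel 0
| trelP (a : K) (u w : tfree) : trel u -> trel w -> trel (a *: u + w).

Definition tnull : {pred tfree} := fun u => `[< trel u >].

Lemma tnull_zmod_closed : zmod_closed tnull.
Proof.
split=> [|u w /asboolP ru /asboolP rw]; first exact/asboolP/trel0.
apply/asboolP; rewrite addrC -scaleN1r; exact: trelP.
Qed.

HB.instance Definition _ :=
  GRing.isZmodClosed.Build tfree tnull tnull_zmod_closed.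

(* E_1 (x) ... (x) E_k *)
Definition tensor : Type := Quotient.quot (tnull : zmodClosed tfree).

HB.instance Definition _ := GRing.Zmodule.on tensor.

Definition tpi (u : tfree) : tensor := \pi_tensor u.

Lemma tpi_eq u w : tpi u = tpi w <-> trel (u - w).
Proof.
split=> [/eqP|r]; first by rewrite -Quotient.idealrBE => /asboolP.
by apply/eqP; rewrite -Quotient.idealrBE; apply/asboolP.
Qed.

Lemma tpi_repr (t : tensor) : tpi (repr t) = t. Proof. exact: reprK. Qed.

Lemma tpiD u w : tpi (u + w) = tpi u + tpi w.
Proof. by rewrite /tpi !piE. Qed.

Definition tscale (a : K) (t : tensor) : tensor := tpi (a *: repr t).

Lemma tscale_pi a u : tscale a (tpi u) = tpi (a *: u).
Proof.
apply/tpi_eq; rewrite -scalerBr -[_ *: _]addr0.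
by apply: trelP trel0; apply/tpi_eq; rewrite tpi_repr.
Qed.

Lemma tscaleA a b t : tscale a (tscale b t) = tscale (a * b) t.
Proof. by rewrite -[t]tpi_repr !tscale_pi scalerA. Qed.
Lemma tscale1 : left_id 1 tscale.
Proof. by move=> t; rewrite -[t]tpi_repr tscale_pi scale1r. Qed.
Lemma tscaleDr : right_distributive tscale +%R.
Proof.
move=> a t t'; rewrite -[t]tpi_repr -[t']tpi_repr -tpiD !tscale_pi -tpiD.
by rewrite scalerDr.
Qed.
Lemma tscaleDl t : {morph tscale^~ t : a b / a + b}.
Proof. by move=> a b; rewrite -[t]tpi_repr !tscale_pi -tpiD scalerDl. Qed.

HB.instance Definition _ := GRing.Zmodule_isLmodule.Build K tensor
  tscaleA tscale1 tscaleDr tscaleDl.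

Lemma tpiZ a u : tpi (a *: u) = a *: tpi u.
Proof. by rewrite -tscale_pi. Qed.

(* x_1 (x) ... (x) x_k *)
Definition tpure (x : forall i, E i) : tensor := tpi << x >>.

Lemma tpure_multilinear : multilinear tpure.
Proof.
move=> v i a x y; rewrite /tpure -tpiZ -tpiD; apply/tpi_eq; exact: trel_mlin.
Qed.

Section Lift.
Variables (W : lmodType K) (f : mlmap E W).

Definition flift (u : tfree) : W := \sum_(v <- msupp u) u@_v *: f v.

Lemma flift_le (d : {fset forall i, E i}) u : (msupp u `<=` d)%fset ->
  flift u = \sum_(v <- d) u@_v *: f v.
Proof.
move=> le; apply: big_fset_incl => // v _ /mcoeff_outdom ->.
by rewrite scale0r.
Qed.

Lemma flift_linear : linear flift.
Proof.
move=> a u w; pose d := (msupp (a *: u + w) `|` (msupp u `|` msupp w))%fset.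
have lu : (msupp u `<=` d)%fset by rewrite /d fsetUCA fsubsetUl.
have lw : (msupp w `<=` d)%fset by rewrite /d fsetUA fsubsetUr.
rewrite (flift_le (fsubsetUl _ _ : _ `<=` d)%fset) (flift_le lu) (flift_le lw).
rewrite scaler_sumr -big_split /=; apply: eq_bigr => v _.
by rewrite mcoeffD mcoeffZ scalerDl scalerA.
Qed.

HB.instance Definition _ := GRing.isLinear.Build K tfree W *:%R flift flift_linear.

Lemma fliftU v : flift << v >> = f v.
Proof.
by rewrite (@flift_le [fset v]%fset) ?msuppU_le // big_seq_fset1 mcoeffUU scale1r.
Qed.

Lemma flift_rel u : trel u -> flift u = 0.
Proof.
elim=> [v i a x y||a {}u w _ ru _ rw]; rewrite ?linear0 //.
- by rewrite linearB linearD linearZ /= !fliftU mlfunP subrr.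
- by rewrite linearD linearZ /= ru rw scaler0 addr0.
Qed.

(* The linear map E_1 (x) ... (x) E_k -> W induced by the multilinear map f;
   tliftE and tensor_ext are the universal property of the tensor product. *)
Definition tlift (t : tensor) : W := flift (repr t).

Lemma tlift_pi u : tlift (tpi u) = flift u.
Proof.
apply/eqP; rewrite -subr_eq0 -linearB; apply/eqP/flift_rel/tpi_eq.
exact: tpi_repr.
Qed.

Lemma tlift_linear : linear tlift.
Proof.
move=> a t t'; rewrite -[t]tpi_repr -[t']tpi_repr -tpiZ -tpiD !tlift_pi.
exact: linearP.
Qed.

HB.instance Definition _ := GRing.isLinear.Build K tensor W *:%R tlift tlift_linear.

Lemma tliftE v : tlift (tpure v) = f v.
Proof. by rewrite tlift_pi fliftU. Qed.

End Lift.

Lemma tensor_ext (W : lmodType K) (g h : {linear tensor -> W}) :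
  (forall v, g (tpure v) = h (tpure v)) -> g =1 h.
Proof.
move=> gh t; rewrite -[t]tpi_repr (monalgE (repr t)).
have P (l : {linear tensor -> W}) (u : tfree) :
    l (tpi (\sum_(v <- msupp u) << u@_v *g v >>)) =
    \sum_(v <- msupp u) u@_v *: l (tpure v).
  elim/big_rec2: _ => [|v y1 y2 _ <-].
    by rewrite -[0]/(0 : tfree) -(scale0r (0 : tfree)) tpiZ scale0r linear0.
  rewrite tpiD linearD -linearZ -tpiZ; congr (l (tpi _) + _).
  by apply/malgP=> w; rewrite mcoeffZ !mcoeffU mulrnAr mulr1.
by rewrite !P; apply: eq_bigr => v _; rewrite gh.
Qed.

End TensorProduct.

Section TensorMap.
Variables (K : fieldType) (k : nat) (E F : 'I_k -> lmodType K).
Variable phi : forall i, {linear E i -> F i}.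

Lemma tensor_map_multilinear :
  multilinear (fun x : forall i, E i => tpure (fun i => phi i (x i))).
Proof.
have dfE v i z : (fun j => phi j (dfwith v z j)) =
    dfwith (fun j => phi j (v j)) (phi i z).
  apply: functional_extensionality_dep => j.
  by case: dfwithP => [|j' ne]; rewrite ?dfwith_in ?dfwith_out.
by move=> v i a x y; rewrite !dfE linearP tpure_multilinear.
Qed.

(* phi_1 (x) ... (x) phi_k, the linear map characterised by tensor_mapE. *)
Definition tensor_map : {linear tensor E -> tensor F} :=
  tlift (MLMap tensor_map_multilinear).

Lemma tensor_mapE (x : forall i, E i) :
  tensor_map (tpure x) = tpure (fun i => phi i (x i)).
Proof. exact: tliftE. Qed.

End TensorMap.

Section TensorPerm.
Variables (K : fieldType) (k : nat) (E : 'I_k -> lmodType K) (s : 'S_k).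

Lemma tensor_perm_multilinear :
  multilinear (fun x : forall i, E i => tpure (fun i => x (s i))).
Proof.
move=> v i'; have [i ->] : exists i, i' = s i.
  by exists ((s^-1)%g i'); rewrite permKV.
move=> a x y.
have dfE z : (fun j => @dfwith _ E v (s i) z (s j)) =
    @dfwith _ (fun j => E (s j)) (fun j => v (s j)) i z.
  apply: functional_extensionality_dep => j.
  have [<-|ne] := eqVneq i j; first by rewrite !dfwith_in.
  by rewrite !dfwith_out // (inj_eq perm_inj).
by rewrite !dfE tpure_multilinear.
Qed.

(* U_s, the linear map characterised by tensor_permE. *)
Definition tensor_perm : {linear tensor E -> tensor (fun i => E (s i))} :=
  tlift (MLMap tensor_perm_multilinear).

Lemma tensor_permE (x : forall i, E i) :
  tensor_perm (tpure x) = tpure (fun i => x (s i)).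
Proof. exact: tliftE. Qed.

End TensorPerm.

(* Main.v *)
Require Import Defs.
From mathcomp Require Import all_boot all_fingroup all_algebra.
From mathcomp Require Import reals complex.
From mathcomp Require Import boolp.

(** Permuting the tensor factors is a natural transformation: both composites
    are linear maps out of a tensor product, hence determined by their values on
    pure tensors ([tensor_ext]).  There, applying the maps factor by factor and
    then reindexing along [s] gives, up to conversion, the same family
    [phi (s i) (x (s i))] as reindexing first. *)

Lemma tensor_perm_natural (K : fieldType) (k : nat) (E F : 'I_k -> lmodType K)
    (s : 'S_k) (phi : forall i : 'I_k, {linear E i -> F i}) :
  tensor_perm F s \o tensor_map phi
    =1 tensor_map (fun i : 'I_k => phi (s i)) \o tensor_perm E s.
Proof.
apply: tensor_ext => x /=.
by rewrite tensor_mapE !tensor_permE tensor_mapE.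
Qed.

Theorem theorem0p3p2 (R : realType) (K : fieldType)
    (hK : K = (R : fieldType) \/ K = (R[i] : fieldType))
    (k : nat) (E : 'I_k -> lmodType K) (s : 'S_k)
    (phi : forall i : 'I_k, {linear E i -> E i}) :
  tensor_perm E s \o tensor_map phi
    = tensor_map (fun i : 'I_k => phi (s i)) \o tensor_perm E s.
Proof. exact/funext/tensor_perm_natural. Qed.
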